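(* Let $p$ be an odd prime number, let $G$ be a finite $p$-group, let $H$ be a subgroup of $G$ and let $\theta\in\operatorname{Irr}(H)$. Assume that $|G:H|=p^2$. Then either $\eta(\theta^G)=1$ or $\eta(\theta^G)\geq \frac{p+1}{2}$.
   Context: For a finite group $G$, $\operatorname{Irr}(G)$ denotes the set of irreducible complex characters of $G$. For a subgroup $H$ of $G$ and a character $\theta$ of $H$, $\theta^G$ denotes the character of $G$ induced by $\theta$. For a character $\Gamma$ of $G$, $\eta(\Gamma)$ denotes the number of distinct irreducible constituents of $\Gamma$ (i.e. the number of $\chi\in\operatorname{Irr}(G)$ with $[\Gamma,\chi]\neq 0$, where $[\cdot,\cdot]$ is the usual inner product of class functions). *)

(* Defs.v *)
From mathcomp Require Import all_boot all_order all_algebra.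
From mathcomp Require Import all_fingroup all_solvable all_field all_character.

Set Implicit Arguments.
Unset Strict Implicit.
Unset Printing Implicit Defensive.

Import GroupScope GRing.Theory.
Local Open Scope ring_scope.

(* The irreducible characters are enumerated without repetition by Iirr G, and
   irr_constt Gamma holds at i exactly when '[Gamma, 'chi_i]_G != 0. *)
Definition eta (gT : finGroupType) (G : {group gT}) (Gamma : 'CF(G)) : nat :=
  #|irr_constt Gamma|.

(* Main.v *)
Require Import Defs.
From mathcomp Require Import all_boot all_order all_algebra.
From mathcomp Require Import all_fingroup all_solvable all_field all_character.
From mathcomp Require Import zify.

Set Implicit Arguments.
Unset Strict Implicit.
Unset Printing Implicit Defensive.

Import GroupScope GRing.Theory Num.Theory.
Local Open Scope ring_scope.

(** The theorem rests on a chain H < M < G of normal steps of index p. Let X be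
    the set of constituents of theta^M. A step of prime index leaves two
    possibilities: the induced character is irreducible, or the character being
    induced is invariant, and then it extends and has p induced constituents,
    the products of one extension with the p linear characters of the quotient.

    If theta^M is irreducible, the same alternative applied to M < G gives 1 or
    p constituents. Otherwise X consists of the p extensions of theta to M. If
    one of them is G-invariant, it alone contributes p constituents. Otherwise
    all members of X induce irreducibly, and two of them have the same induced
    character exactly when they are conjugate in G; so the number of constituents
    of theta^G is the number of G-classes that meet X. It remains to see that,
    if some class meets X in at least three members, then it contains X
    (three_conjugate_extensions). In the remaining case every class meets X in at
    most two members, so at least p / 2 classes are needed.

    Suppose then that chi, chi^g = chi mu and chi^(g^k) = chi nu lie in X, with
    1 < k < p and mu, nu linear with kernel containing H. Since
    chi^(g^k) = chi mu mu^g ... mu^(g^(k-1)), the linear characters nu and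
    mu mu^g ... mu^(g^(k-1)) agree wherever chi does not vanish, hence on the
    subgroup K generated by these points, which g normalises. If mu^g <> mu on K,
    then, with a = g^-1, choosing y in K so that mu detects an iterated commutator
    with a that is as long as possible makes i |-> mu(y^(a^i)) a geometric
    progression of ratio mu(z) <> 1, with z = [y, a]
    (lin_char_geometric_orbit). Evaluating at z gives nu(z) = mu(z)^k, so
    nu = mu^k because z is outside H; evaluating at y then gives
    mu(z)^(k (k - 1) / 2) = 1, impossible as mu(z) has order p and 1 < k < p
    (collinear_conj_fixes_multiplier). So mu^g = mu on K, whence
    chi^(g^n) = chi mu^n for all n (collinear_conj_progression), and the p
    conjugates of chi all lie in X, which has only p members. *)

(** * Counting fibres *)

Lemma card_le2_imset (T U : finType) (f : T -> U) (A : {set T}) :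
  (forall x y z, x \in A -> y \in A -> z \in A ->
     x != y -> y != z -> z != x -> f x = f y -> f x = f z -> False) ->
  (#|A| <= 2 * #|f @: A|)%N.
Proof.
move=> fibre2; rewrite -sum1_card (partition_big_imset f) /= mulnC -sum_nat_const.
apply: leq_sum => u _; rewrite sum1_card leqNgt; apply/negP.
case/card_gt2P=> x [y [z [[xA yA zA] [xy yz zx]]]].
have [/andP[Ax /eqP fx] /andP[Ay /eqP fy] /andP[Az /eqP fz]] := And3 xA yA zA.
by apply: (fibre2 x y z); rewrite // fx.
Qed.

(** * Linear characters and the points where a class function does not vanish *)

Section LinearCharacters.

Variables (gT : finGroupType) (M : {group gT}).
Implicit Types alpha beta : 'CF(M).

Lemma lin_char_eq_gen alpha beta (A : {set gT}) :
    alpha \is a linear_char -> beta \is a linear_char -> A \subset M ->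
  {in A, alpha =1 beta} -> {in <<A>>, alpha =1 beta}.
Proof.
move=> Lalpha Lbeta sAM eqA.
have gE: group_set [set x in M | alpha x == beta x].
  apply/group_setP; split=> [|x y].
    by rewrite inE group1 !lin_char1 /=.
  rewrite !inE => /andP[Mx /eqP ex] /andP[My /eqP ey].
  by rewrite groupM // !lin_charM // ex ey eqxx.
have /subsetP sAE: <<A>> \subset group gE.
  rewrite gen_subG; apply/subsetP=> x Ax.
  by rewrite inE (subsetP sAM) //= eqA.
by move=> x /sAE; rewrite inE => /andP[_ /eqP].
Qed.

(** A subgroup of prime index is maximal, so H and z generate M. *)
Lemma lin_char_eq_prime_index (H : {group gT}) alpha beta z :
    alpha \is a linear_char -> beta \is a linear_char ->
    H \subset cfker alpha -> H \subset cfker beta ->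
    H \subset M -> prime #|M : H| -> z \in M -> z \notin H ->
  alpha z = beta z -> alpha = beta.
Proof.
move=> Lalpha Lbeta kalpha kbeta sHM prMH Mz H'z eqz.
have /maxgroupP[_ maxH] := p_index_maximal sHM prMH.
have sHzM : z |: H \subset M by rewrite subUset sub1set Mz.
have defM : <<z |: H>> = M.
  apply/eqP; rewrite eqEproper gen_subG sHzM /=; apply/negP=> ltM.
  have := maxH _ ltM; rewrite (subset_trans (subsetUr _ _) (subset_gen _)).
  move/(_ isT)=> /= eqH; case/negP: H'z; rewrite -eqH.
  by rewrite mem_gen // setU11.
apply/cfun_inP=> x; rewrite -{1}defM; apply: lin_char_eq_gen x => // x.
case/setU1P=> [-> // | Hx].
by rewrite (cfker1 (subsetP kalpha x Hx)) (cfker1 (subsetP kbeta x Hx)) !lin_char1.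
Qed.

Definition nonvanishing (chi : 'CF(M)) := [set x in M | chi x != 0].

(** The equation can only be cancelled pointwise off the zeros of chi, but the
    points where two linear characters agree form a subgroup. *)
Lemma lin_char_eq_on_gen_nonvanishing chi alpha beta :
    alpha \is a linear_char -> beta \is a linear_char ->
  chi * alpha = chi * beta -> {in <<nonvanishing chi>>, alpha =1 beta}.
Proof.
move=> Lalpha Lbeta eqab; apply: lin_char_eq_gen => //.
  by apply/subsetP=> x; rewrite inE => /andP[].
move=> x; rewrite inE => /andP[_ nz]; apply: (mulfI nz).
by move/cfunP/(_ x): eqab; rewrite !cfunE.
Qed.

Lemma mul_eq_on_nonvanishing chi alpha beta :
  {in nonvanishing chi, alpha =1 beta} -> chi * alpha = chi * beta.
Proof.
move=> eqab; apply/cfun_inP=> x Mx; rewrite !cfunE.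
have [-> | nz] := eqVneq (chi x) 0; first by rewrite !mul0r.
by rewrite eqab // inE Mx.
Qed.

(** Multiplying by a linear character does not change the zeros. *)
Lemma norm_nonvanishing chi mu g :
    mu \is a linear_char -> g \in 'N(M) -> (chi ^ g)%CF = chi * mu ->
  g \in 'N(<<nonvanishing chi>>).
Proof.
move=> Lmu nMg chig; apply: (subsetP (norm_gen _)); rewrite -groupV inE.
apply/subsetP=> _ /imsetP[x /[!inE]/andP[Mx nz] ->].
rewrite memJ_norm ?groupV // Mx /=.
move/cfunP/(_ x): chig; rewrite cfConjgE // => ->; rewrite cfunE.
by rewrite mulf_neq0 // lin_char_neq0.
Qed.

End LinearCharacters.

(** * Conjugates that differ by linear factors *)

Lemma iter_commg_nilpotent (gT : finGroupType) (G : {group gT}) a :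
    nilpotent G -> a \in G ->
  exists n, {in G, forall x, iter n (fun y => [~ y, a]) x = 1%g}.
Proof.
move=> /lcnP[n Gn1] Ga; exists n => x Gx; apply/set1gP; rewrite -Gn1.
elim: n {Gn1} => [|n IHn] /=; first by rewrite lcn1.
by rewrite lcnSn mem_commg.
Qed.

(** Among the elements of K, take w and the largest n such that mu is nontrivial
    on the n-fold commutator of w with a; nilpotency bounds n, and x shows that
    n > 0. For y the (n-1)-fold commutator of w, the ratio of consecutive values
    mu(y^(a^i)) is the value of mu on the n-fold commutator of w^(a^i), and it
    does not depend on i by maximality of n. *)
Lemma lin_char_geometric_orbit (gT : finGroupType) (G M K : {group gT})
    (mu : 'CF(M)) a x :
    mu \is a linear_char -> K \subset M -> K \subset G -> nilpotent G ->
    a \in G -> a \in 'N(K) -> x \in K -> mu [~ x, a] != 1 ->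
  exists y, [/\ y \in K, mu [~ y, a] != 1
    & forall i, mu (y ^ (a ^+ i))%g = mu y * mu [~ y, a] ^+ i].
Proof.
move=> Lmu sKM sKG nilG Ga nKa Kx mu_x.
pose d n := iter n (fun y => [~ y, a]).
have dK n y : y \in K -> d n y \in K.
  move=> Ky; elim: n => //= n IHn.
  by rewrite commgEl groupM ?groupV ?memJ_norm.
have dJ n i y : d n (y ^ (a ^+ i))%g = (d n y ^ (a ^+ i))%g.
  elim: n => //= n ->; rewrite conjRg; congr [~ _, _].
  by rewrite conjgE commuteX // mulKg.
have [N dN] := iter_commg_nilpotent nilG Ga.
pose P n := [exists y in K, mu (d n y) != 1].
have P1 : exists n, P n by exists 1%N; apply/existsP; exists x; rewrite Kx.
have PN n : P n -> (n <= N)%N.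
  case/existsP=> y /andP[Ky]; apply: contraR; rewrite -ltnNge => /ltnW lt.
  suff ->: d n y = 1%g by rewrite lin_char1.
  rewrite -(subnK lt) /d iterD dN ?(subsetP sKG) //.
  by elim: (n - N)%N => //= m ->; rewrite comm1g.
case: (ex_maxnP P1 PN) => t /existsP[w /andP[Kw mu_w]] max_t.
have mu1 i y : y \in K -> (t < i)%N -> mu (d i y) = 1.
  move=> Ky lt; apply/eqP; apply: contraTT lt => nmu; rewrite -leqNgt.
  by apply: max_t; apply/existsP; exists y; rewrite Ky.
have t_gt0 : (0 < t)%N.
  by apply: max_t; apply/existsP; exists x; rewrite Kx.
case: t t_gt0 => // t _ in mu_w max_t mu1 *.
have nKai i : (a ^+ i)%g \in 'N(K) by rewrite groupX.
have Ky := dK t w Kw; set y := d t w in Ky.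
exists y; split=> // i.
have step u : u \in K -> mu (u ^ a)%g = mu u * mu [~ u, a].
  move=> Ku; have Kc := dK 1%N u Ku.
  by rewrite conjg_mulR lin_charM // (subsetP sKM).
(* Consecutive values differ by the value of mu on a (t + 2)-fold commutator,
   which is 1 by maximality. *)
have zi j : mu (d t.+1 (w ^ (a ^+ j)))%g = mu [~ y, a].
  elim: j => [|j IHj]; first by rewrite expg0 conjg1.
  rewrite dJ expgSr conjgM -dJ step ?dK ?memJ_norm //.
  by rewrite (mu1 t.+2) ?mulr1 ?memJ_norm.
elim: i => [|i IHi]; first by rewrite expg0 conjg1 mulr1.
rewrite expgSr conjgM step ?memJ_norm // IHi -dJ exprSr mulrA.
by congr (_ * _); rewrite -(zi i).
Qed.

(** The linear characters linking chi to its conjugates under powers of g are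
    forced to be partial products of mu, mu^g, mu^(g^2), and so on. If mu^g
    differed from mu at some point where chi does not vanish, the exponents of
    mu(z) in these partial products would grow quadratically, like the binomial
    coefficients 'C(k, 2), whereas nu, being trivial on H, only allows linear
    growth. Nothing is known of mu^g where chi vanishes, hence the factor chi in
    the conclusion. *)
Lemma collinear_conj_fixes_multiplier (gT : finGroupType) (G M H : {group gT})
    (chi mu nu : 'CF(M)) g k :
    prime #|M : H| -> H <| M -> M <| G -> nilpotent G ->
    mu \is a linear_char -> nu \is a linear_char ->
    H \subset cfker mu -> H \subset cfker nu ->
    g \in G -> (1 < k < #|M : H|)%N ->
    (chi ^ g)%CF = chi * mu -> (chi ^ (g ^+ k)%g)%CF = chi * nu ->
  chi * (mu ^ g)%CF = chi * mu.
Proof.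
set p := #|M : H| => pr_p nsHM nsMG nilG Lmu Lnu kmu knu Gg /andP[k_gt1 ltkp].
move=> chi_g chi_gk; have [sMG nMG] := andP nsMG; have nMg := subsetP nMG g Gg.
have sHM := normal_sub nsHM.
pose K := <<nonvanishing chi>>%G.
have sKM: K \subset M by rewrite gen_subG; apply/subsetP=> x; rewrite inE; case/andP.
have nKg : g \in 'N(K) := norm_nonvanishing Lmu nMg chi_g.
pose zeta n := \prod_(i < n) (mu ^ (g ^+ i)%g)%CF.
have Lzeta n : zeta n \is a linear_char.
  by rewrite rpred_prod // => i _; apply: cfConjg_lin_char.
have chi_gn n : (chi ^ (g ^+ n)%g)%CF = chi * zeta n.
  elim: n => [|n IHn]; first by rewrite expg0 cfConjgJ1 /zeta big_ord0 mulr1.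
  rewrite expgSr (cfConjgM _ nsMG) ?groupX // IHn rmorphM /= chi_g -mulrA.
  rewrite /zeta big_ord_recl expg0 cfConjgJ1 rmorph_prod; congr (_ * (_ * _)).
  by apply: eq_bigr => i _; rewrite lift0 expgSr (cfConjgM _ nsMG) ?groupX.
have eqzn : {in K, zeta k =1 nu}.
  by apply: lin_char_eq_on_gen_nonvanishing => //; rewrite -chi_gn.
pose a := (g^-1)%g; have Ga : a \in G by rewrite groupV.
have nKa : a \in 'N(K) by rewrite groupV.
have muJ i x : (mu ^ (g ^+ i)%g)%CF x = mu (x ^ (a ^+ i))%g.
  by rewrite cfConjgE ?groupX // expgVn.
apply: mul_eq_on_nonvanishing => x nz_x; have Kx : x \in K by rewrite mem_gen.
have Mx := subsetP sKM x Kx.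
have nMa: a \in 'N(M) by rewrite groupV.
rewrite -{1}[g]expg1 muJ expg1 conjg_mulR.
have Mxa : [~ x, a] \in M by rewrite commgEl groupM ?groupV ?memJ_norm.
rewrite lin_charM //; apply/eqP; rewrite -subr_eq0 -{2}[mu x]mulr1 -mulrBr mulf_eq0.
rewrite (negPf (lin_char_neq0 Lmu Mx)) subr_eq0 /=; apply: contraT => mu_xa.
have [y [Ky mu_z muy]] :=
  lin_char_geometric_orbit Lmu sKM (subset_trans sKM sMG) nilG Ga nKa Kx mu_xa.
set z := [~ y, a] in mu_z muy.
have Kz : z \in K by rewrite /z commgEl groupM ?groupV ?memJ_norm.
have [My Mz] := (subsetP sKM y Ky, subsetP sKM z Kz).
have H'z : z \notin H.
  by apply: contra mu_z => /(subsetP kmu)/cfker1->; rewrite lin_char1.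
(* z^(a^i) is the quotient of y^(a^(i+1)) by y^(a^i), so this is the ratio of
   the geometric progression. *)
have muz i : mu (z ^ (a ^+ i))%g = mu z.
  have ->: (z ^ (a ^+ i) = (y ^ (a ^+ i))^-1 * y ^ (a ^+ i.+1))%g.
    by rewrite /z commgEl conjMg conjVg -conjgM -expgS.
  have Myi l : (y ^ (a ^+ l))%g \in M by rewrite memJ_norm ?groupX.
  rewrite lin_charM ?lin_charV ?groupV // !muy exprSr [mu y * (_ * _)]mulrA mulKf //.
  by rewrite -muy lin_char_neq0.
have zeta_z : zeta k z = mu z ^+ k.
  rewrite prod_cfunE // (eq_bigr (fun=> mu z)) ?prodr_const ?card_ord // => i _.
  by rewrite muJ.
(* The binomial coefficient is the sum 0 + 1 + ... + (k - 1) of the exponents. *)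
have zeta_y : zeta k y = mu y ^+ k * mu z ^+ 'C(k, 2).
  rewrite prod_cfunE // (eq_bigr (fun i : 'I_k => mu y * mu z ^+ i)).
    by rewrite big_split prodr_const card_ord /= -expr_sum -bin2_sum big_mkord.
  by move=> i _; rewrite muJ muy.
have nu_mu : nu = mu ^+ k.
  apply: (lin_char_eq_prime_index (H := H) (z := z)) => //.
  - exact: rpredX.
  - apply/subsetP=> h Hh; have Mh := subsetP sHM h Hh.
    rewrite cfkerEchar ?lin_charW ?rpredX // inE Mh !exp_cfunE //.
    by rewrite (cfker1 (subsetP kmu h Hh)) eqxx.
  by rewrite exp_cfunE // -zeta_z eqzn.
have /eqP := eqzn y Ky; rewrite zeta_y nu_mu exp_cfunE // -subr_eq0.
rewrite -{2}[_ ^+ k]mulr1 -mulrBr mulf_eq0 expf_eq0 (negPf (lin_char_neq0 Lmu My)).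
rewrite andbF subr_eq0 /= => /eqP muzC.
have muzp : mu z ^+ p = 1.
  rewrite -lin_charX // (cfker1 (subsetP kmu _ _)) ?lin_char1 //.
  have nHz := subsetP (normal_norm nsHM) z Mz.
  rewrite coset_idr ?groupX // morphX //.
  rewrite /p -card_quotient ?normal_norm //.
  by rewrite expg_cardG // mem_quotient.
(* 1 < k < p, so p divides neither factor of 'C(k, 2) * 2 = k * (k - 1). *)
have co : coprime p 'C(k, 2).
  rewrite prime_coprime //; apply/negP=> /(dvdn_mulr 2`!); rewrite bin_ffact.
  rewrite ffactnS ffactn1 Euclid_dvdM // !gtnNdvd // ?(ltnW k_gt1) -?subn1 ?subn_gt0 //.
  exact: leq_ltn_trans (leq_subr 1 k) ltkp.
have [m prim_m m_p] := prim_order_exists (prime_gt0 pr_p) muzp.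
have m_C : (m %| 'C(k, 2))%N by rewrite (prim_order_dvd prim_m) muzC.
have /eqP m1 : m == 1%N by rewrite -dvdn1 -(eqP co) dvdn_gcd m_p.
by case/eqP: mu_z; rewrite -[LHS]expr1 -m1 (prim_expr_order prim_m).
Qed.

Lemma collinear_conj_progression (gT : finGroupType) (G M : {group gT})
    (chi mu : 'CF(M)) g n :
    M <| G -> g \in G ->
    (chi ^ g)%CF = chi * mu -> chi * (mu ^ g)%CF = chi * mu ->
  (chi ^ (g ^+ n)%g)%CF = chi * mu ^+ n.
Proof.
move=> nsMG Gg chi_g mu_g; elim: n => [|n IHn].
  by rewrite expg0 cfConjgJ1 mulr1.
rewrite expgSr (cfConjgM _ nsMG) ?groupX // IHn rmorphM rmorphXn /= chi_g.
have ->: chi * mu * (mu ^ g)%CF ^+ n = chi * (mu ^ g)%CF ^+ n * mu by rewrite mulrAC.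
suffices ->: chi * (mu ^ g)%CF ^+ n = chi * mu ^+ n by rewrite exprSr mulrA.
elim: n {IHn} => [|n IHn]; first by rewrite !expr0.
by rewrite !exprS !mulrA mu_g mulrAC IHn mulrAC.
Qed.

(** * Constituents of characters induced from subgroups of prime index *)

Lemma prime_index_cosets (gT : finGroupType) (G M : {group gT}) g h :
    M <| G -> prime #|G : M| -> g \in G -> g \notin M -> h \in G ->
  exists m k, [/\ m \in M, (k < #|G : M|)%N & h = (m * g ^+ k)%g].
Proof.
move=> nsMG pr_p Gg M'g Gh; have nMG := normal_norm nsMG.
have [nMg nMh] := (subsetP nMG g Gg, subsetP nMG h Gh).
rewrite -card_quotient // in pr_p *.
have Qg : coset M g \in (G / M)%g by rewrite mem_quotient.
have og : #[coset M g] = #|(G / M)%g|.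
  have [_ /(_ _ (order_dvdG Qg))] := primeP pr_p.
  case/pred2P=> [/eqP | //]; rewrite order_eq1 => /eqP/coset_idr.
  by move/(_ nMg) => Mg; rewrite Mg in M'g.
have defQ : <[coset M g]> = (G / M)%g.
  by apply/eqP; rewrite eqEcard cycle_subG Qg -og /=.
have : coset M h \in <[coset M g]> by rewrite defQ mem_quotient.
case/cyclePmin=> k; rewrite og => ltk; rewrite -morphX // => /rcoset_kercosetP.
case/(_ nMh (groupX k nMg))/rcosetP=> m Mm ->.
by exists m, k.
Qed.

Section Constituents.

Variables (gT : finGroupType) (G M : {group gT}).

Lemma constt_Ind_trans (phi : 'CF(M)) i :
    phi \is a character -> i \in irr_constt phi ->
  {subset irr_constt ('Ind[G] 'chi_i) <= irr_constt ('Ind[G] phi)}.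
Proof.
move=> Nphi /(constt_charP _ Nphi)[psi Npsi ->] j.
have ge0 (xi : 'CF(M)) : xi \is a character -> 0 <= '['Ind[G] xi, 'chi_j].
  by move=> Nxi; apply: natr_ge0; apply: Cnat_cfdot_char_irr; apply: cfInd_char.
rewrite !irr_consttE linearD /= cfdotDl => nz.
by rewrite paddr_eq0 ?(negPf nz) // ge0 ?irr_char.
Qed.

(** This turns counting the constituents of an induced character into counting
    the values of induction on the constituents below. *)
Lemma irr_constt_Ind_imset (phi : 'CF(M)) :
    phi \is a character ->
    {in irr_constt phi, forall i, 'Ind[G] 'chi_i \in irr G} ->
  irr_constt ('Ind[G] phi) =i Ind_Iirr G @: [set i in irr_constt phi].
Proof.
move=> Nphi irrInd j; apply/idP/imsetP=> [|[i]]; last first.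
  rewrite inE => Xi ->; apply: (constt_Ind_trans Nphi Xi).
  by rewrite -[in X in _ \in X](cfIirrE (irrInd i Xi)) constt_irr inE.
rewrite irr_consttE {1}[phi]cfun_sum_constt linear_sum cfdot_suml => nz.
have [i Xi nz_i] : exists2 i, i \in irr_constt phi & '['Ind[G] 'chi_i, 'chi_j] != 0.
  apply/exists_inP; apply: contraR nz => /exists_inPn z.
  rewrite big1 // => i Xi; rewrite linearZ /= cfdotZl.
  by move/negPn/eqP: (z i Xi) ->; rewrite mulr0.
exists i; first by rewrite inE.
by move: nz_i; rewrite -(cfIirrE (irrInd i Xi)) cfdot_irr pnatr_eq0 eqb0 negbK => /eqP.
Qed.

Hypothesis nsMG : M <| G.

(** Both characters are constituents of the restriction of the common induced
    irreducible character, so Clifford's theorem makes them conjugate. *)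
Lemma cfclass_Ind_irr i j :
    'Ind[G] 'chi[M]_i \in irr G -> 'Ind[G] 'chi_i = 'Ind[G] 'chi_j ->
  ('chi_j \in 'chi_i ^: G)%CF.
Proof.
case/irrP=> t def_t eq_ij.
have Xi : i \in irr_constt ('Res[M] 'chi_t) by rewrite -constt_Ind_Res def_t constt_irr inE.
have Xj : j \in irr_constt ('Res[M] 'chi_t).
  by rewrite -constt_Ind_Res -eq_ij def_t constt_irr inE.
apply: contraLR Xj => notij; rewrite irr_consttE negbK.
rewrite (Clifford_Res_sum_cfclass nsMG Xi) cfdotZl reindex_cfclass // cfdot_suml big1 ?mulr0 //.
by move=> k cl_k; rewrite cfdot_irr; case: eqP => // eq_kj; case/negP: notij; rewrite -eq_kj.
Qed.

Hypothesis pr_p : prime #|G : M|.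

(** The inertia group lies between M and G, so it is one of them; when it is M,
    the Clifford correspondence is induction from M itself. *)
Lemma cfInd_prime_irr_or_invariant i :
  'Ind[G] 'chi[M]_i \in irr G \/ G \subset 'I['chi_i].
Proof.
have [sMG nMG] := andP nsMG; have sMI := sub_Inertia 'chi_i sMG.
have sIG := Inertia_sub G 'chi_i.
have [invG | ninvG] := boolP (G \subset 'I['chi_i]); [by right | left].
have /maxgroupP[_ maxM] := p_index_maximal sMG pr_p.
have defI : 'I_G['chi_i]%G = M.
  apply/group_inj/maxM => //; rewrite properE sIG /=.
  by apply: contra ninvG => /subset_trans-> //; apply: subsetIr.
have [irrI _ _ _ _] := constt_Inertia_bijection i nsMG.
by move: irrI; rewrite defI cfInd_id; apply; rewrite constt_irr inE.
Qed.

(** An invariant character extends across a cyclic quotient, and Gallagher's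
    theorem parametrises the constituents by the characters of that quotient. *)
Lemma card_constt_Ind_prime_invariant i :
  G \subset 'I['chi[M]_i] -> #|irr_constt ('Ind[G] 'chi_i)| = #|G : M|.
Proof.
move=> invG; have [t ext_t] := prime_invariant_irr_extendible nsMG erefl pr_p invG.
have [_ inj_t def_t _] := constt_Ind_ext nsMG ext_t.
rewrite (eq_card def_t) card_codom // card_Iirr_abelian ?card_quotient ?normal_norm //.
by rewrite cyclic_abelian // prime_cyclic // card_quotient ?normal_norm.
Qed.

Lemma constt_Ind_prime_invariantE i j :
    G \subset 'I['chi[M]_i] ->
  (j \in irr_constt ('Ind[G] 'chi_i)) = ('Res[M] 'chi_j == 'chi_i).
Proof.
move=> invG; apply/idP/eqP=> [|ext_j]; last first.
  by rewrite constt_Ind_Res ext_j constt_irr inE.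
have [t ext_t] := prime_invariant_irr_extendible nsMG erefl pr_p invG.
have [irr_t _ -> _] := constt_Ind_ext nsMG ext_t => /codomP[b ->].
have [sMG nMG] := andP nsMG.
have lin_b : 'chi_b \is a linear_char.
  by apply/char_abelianP; rewrite cyclic_abelian // prime_cyclic // card_quotient.
rewrite cfIirrE // rmorphM /= ext_t mod_IirrE //.
have -> : 'Res[M] ('chi_b %% M)%CF = 1.
  by rewrite cfRes_sub_ker ?cfker_mod // cfMod1 lin_char1 // scale1r.
by rewrite mul1r.
Qed.

Lemma prime_index_ext_mul_lin j k :
    'Res[M] 'chi[G]_j \in irr M -> 'Res[M] 'chi_k = 'Res[M] 'chi_j ->
  exists2 mu : 'CF(G), mu \is a linear_char /\ M \subset cfker mu
    & 'chi_k = 'chi_j * mu.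
Proof.
case/irrP=> i ext_j; rewrite ext_j => ext_k.
have [irr_j _ def_j _] := constt_Ind_ext nsMG ext_j.
have : k \in irr_constt ('Ind[G] 'chi_i) by rewrite constt_Ind_Res ext_k constt_irr inE.
rewrite def_j => /codomP[b ->]; have [sMG nMG] := andP nsMG.
have lin_b : 'chi_b \is a linear_char.
  by apply/char_abelianP; rewrite cyclic_abelian // prime_cyclic // card_quotient.
exists ('chi_b %% M)%CF; first by rewrite cfMod_lin_char ?cfker_mod.
by rewrite cfIirrE // mod_IirrE // mulrC.
Qed.

End Constituents.

(** * Extensions lying in one conjugacy class *)

(** Writing the second and third characters as conjugates of the first under g
    and g^k modulo M, with 1 < k < p since the three are distinct, gives the
    hypotheses of collinear_conj_fixes_multiplier. All conjugates of the first are
    then its products with powers of one linear character trivial on H, so they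
    extend the same character of H; there are as many of them as there are
    extensions. *)
Lemma three_conjugate_extensions (gT : finGroupType) (G M H : {group gT})
    (s : Iirr H) (i j l : Iirr M) :
    H <| M -> M <| G -> nilpotent G ->
    prime #|M : H| -> #|G : M| = #|M : H| -> M \subset 'I['chi_s] ->
    'Res[H] 'chi_i = 'chi_s -> 'Res[H] 'chi_j = 'chi_s ->
    'Res[H] 'chi_l = 'chi_s ->
    i != j -> j != l -> l != i ->
    ('chi_j \in 'chi_i ^: G)%CF -> ('chi_l \in 'chi_i ^: G)%CF ->
  forall m, 'Res[H] 'chi_m = 'chi_s -> ('chi_m \in 'chi_i ^: G)%CF.
Proof.
move=> nsHM nsMG nilG pr_p iGM inv_s ext_i ext_j ext_l ij jl li.
have pr_pG : prime #|G : M| by rewrite iGM.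
have [sMG nMG] := andP nsMG.
have ext_mul k : 'Res[H] 'chi_k = 'chi_s -> exists2 mu : 'CF(M),
    mu \is a linear_char /\ H \subset cfker mu & 'chi_k = 'chi_i * mu.
  by move=> ext_k; apply: prime_index_ext_mul_lin; rewrite // ext_i ?mem_irr.
have [mu [Lmu kmu] def_j] := ext_mul j ext_j.
have [nu [Lnu knu] def_l] := ext_mul l ext_l.
case/cfclassP=> g Gg chi_g /cfclassP[h Gh chi_h].
have M'g : g \notin M.
  by apply: contra ij => Mg; rewrite -(inj_eq irr_inj) chi_g cfConjg_id.
have conj_pow y : y \in G ->
    exists2 k, (k < #|M : H|)%N & ('chi_i ^ y = 'chi_i ^ (g ^+ k)%g)%CF.
  case/(prime_index_cosets nsMG pr_pG Gg M'g)=> m [k [Mm ltk ->]].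
  exists k; first by rewrite -iGM.
  have Gm := subsetP sMG m Mm.
  by rewrite (cfConjgM _ nsMG Gm) ?groupX // (cfConjg_id _ Mm).
have [k ltkp chi_hk] := conj_pow h Gh.
have k_gt1 : (1 < k)%N.
  case: k chi_hk {ltkp} => [|[|k]] // chi_hk.
    by rewrite expg0 cfConjgJ1 -chi_h in chi_hk; rewrite (irr_inj chi_hk) eqxx in li.
  by rewrite expg1 -chi_h -chi_g in chi_hk; rewrite (irr_inj chi_hk) eqxx in jl.
have mu_g : 'chi_i * (mu ^ g)%CF = 'chi_i * mu.
  apply: (collinear_conj_fixes_multiplier (k := k) (nu := nu) pr_p nsHM nsMG) => //.
  - by rewrite k_gt1.
  - by rewrite -chi_g.
  - by rewrite -chi_hk -chi_h.
have orbX : cfclass_Iirr G i \subset [set m : Iirr M | 'Res[H] 'chi_m == 'chi_s].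
  apply/subsetP=> m; rewrite cfclass_IirrE inE => /cfclassP[y Gy ->].
  have [k' _ ->] := conj_pow y Gy.
  have ->: ('chi_i ^ (g ^+ k')%g)%CF = 'chi_i * mu ^+ k'.
    by apply: (collinear_conj_progression _ nsMG); rewrite -?chi_g.
  rewrite rmorphM rmorphXn /= (cfRes_sub_ker kmu) lin_char1 //.
  by rewrite scale1r expr1n mulr1 ext_i.
have card_orb : #|cfclass_Iirr G i| = #|M : H|.
  have dvd_p : (#|cfclass_Iirr G i| %| #|M : H|)%N.
    rewrite card_cfclass_Iirr // -iGM -(Lagrange_index (Inertia_sub G 'chi_i)).
      exact: dvdn_mulr.
    exact: sub_Inertia.
  have [_ /(_ _ dvd_p)/pred2P[]] // := primeP pr_p.
  rewrite card_cfclass_Iirr // => /eqP; rewrite indexg_eq1 => sGI.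
  have := subsetP sGI g Gg; rewrite inE Gg => /inertiaJ eq_g.
  by case/eqP: ij; apply: irr_inj; rewrite chi_g eq_g.
have cardX : #|[set m : Iirr M | 'Res[H] 'chi_m == 'chi_s]| = #|M : H|.
  rewrite -[RHS](card_constt_Ind_prime_invariant nsHM pr_p inv_s) -[RHS]cardsE.
  by apply: eq_card => m; rewrite inE [RHS]inE constt_Ind_prime_invariantE.
have defX : cfclass_Iirr G i = [set m : Iirr M | 'Res[H] 'chi_m == 'chi_s].
  by apply/eqP; rewrite eqEcard orbX card_orb cardX /=.
by move=> m ext_m; rewrite -cfclass_IirrE defX inE ext_m.
Qed.

(** * Counting the constituents *)

Lemma p_group_index_p2_chain (p : nat) (gT : finGroupType) (G H : {group gT}) :
    prime p -> p.-group G -> H \subset G -> #|G : H| = (p ^ 2)%N ->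
  exists M : {group gT}, [/\ H <| M, M <| G, #|M : H| = p & #|G : M| = p].
Proof.
move=> pr_p pG sHG iGH.
have ltHG : H \proper G.
  rewrite properEneq sHG andbT; apply: contraPneq iGH => ->; rewrite indexgg.
  by apply/eqP; rewrite neq_ltn (@ltn_exp2l p 0 2) ?prime_gt1.
have [M maxM sHM] := maxgroup_exists (gP := fun K : {group gT} => K \proper G) ltHG.
have iGM : #|G : M| = p := p_maximal_index pG maxM.
have sMG := proper_sub (maxgroupp maxM).
have iMH : #|M : H| = p.
  apply/eqP; rewrite -(eqn_pmul2l (prime_gt0 pr_p)) -{1}iGM Lagrange_index //.
  by rewrite iGH.
exists M; split=> //; last exact: p_maximal_normal pG maxM.
apply: p_maximal_normal (pgroupS sMG pG) _.
by apply: p_index_maximal; rewrite ?iMH.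
Qed.

Theorem theoremA (p : nat) (gT : finGroupType) (G H : {group gT})
    (theta : 'CF(H)) :
  prime p -> odd p -> p.-group G -> H \subset G -> theta \in irr H ->
  #|G : H| = (p ^ 2)%N ->
  eta ('Ind[G] theta) = 1%N \/ ((p + 1) %/ 2 <= eta ('Ind[G] theta))%N.
Proof.
move=> pr_p _ pG sHG /irrP[s ->] iGH; rewrite /eta.
have [M [nsHM nsMG iMH iGM]] := p_group_index_p2_chain pr_p pG sHG iGH.
have [sHM sMG] := (normal_sub nsHM, normal_sub nsMG).
have [pr_MH pr_GM] : prime #|M : H| /\ prime #|G : M| by rewrite iMH iGM.
have large n : (p <= 2 * n)%N -> ((p + 1) %/ 2 <= n)%N by lia.
have p_le n : (p <= n)%N -> ((p + 1) %/ 2 <= n)%N by move=> ?; apply: large; lia.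
rewrite -(cfIndInd _ sMG sHM).
have [irr_theta | inv_theta] := cfInd_prime_irr_or_invariant nsHM pr_MH s.
  case/irrP: irr_theta => i ->.
  have [/irrP[t ->] | inv_i] := cfInd_prime_irr_or_invariant nsMG pr_GM i.
    by left; rewrite (eq_card (constt_irr t)) card1.
  by right; rewrite card_constt_Ind_prime_invariant // iGM p_le.
have Nind : 'Ind[M] 'chi_s \is a character by rewrite cfInd_char ?irr_char.
pose X := [set i in irr_constt ('Ind[M] 'chi_s)].
have cardX : #|X| = p by rewrite cardsE card_constt_Ind_prime_invariant.
have extX i : (i \in X) = ('Res[H] 'chi_i == 'chi_s).
  by rewrite inE constt_Ind_prime_invariantE.
have [/exists_inP[i Xi inv_i] | noinv] := boolP [exists i in X, G \subset 'I['chi_i]].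
  right; apply: p_le; rewrite -iGM -(card_constt_Ind_prime_invariant nsMG pr_GM inv_i).
  apply: subset_leq_card; apply/subsetP; apply: constt_Ind_trans => //.
  by rewrite inE in Xi.
have irrX : {in irr_constt ('Ind[M] 'chi_s), forall i, 'Ind[G] 'chi_i \in irr G}.
  move=> i Xi; have [// | inv_i] := cfInd_prime_irr_or_invariant nsMG pr_GM i.
  by case/exists_inP: noinv; exists i; rewrite ?inE.
rewrite (eq_card (irr_constt_Ind_imset Nind irrX)) -/X.
have irrX' i : i \in X -> 'Ind[G] 'chi_i \in irr G by rewrite inE; apply: irrX.
(* If induction takes a single value on X there is one constituent; otherwise no
   fibre may contain three members of X, for such a fibre would be all of X. *)
have [one | many] := leqP #|Ind_Iirr G @: X| 1.
  left; apply/eqP; rewrite eqn_leq one card_gt0.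
  apply: contraTneq (prime_gt0 pr_p) => /eqP; rewrite imset_eq0 -cardX => /eqP->.
  by rewrite cards0.
right; apply: large; rewrite -cardX; apply: card_le2_imset.
move=> i j l Xi Xj Xl ij jl li eq_ij eq_il; move: many; apply/negP; rewrite -leqNgt.
have IndE k : k \in X -> 'chi_(Ind_Iirr G k) = 'Ind[G] 'chi_k.
  by move/irrX'; apply: cfIirrE.
have conjX k : k \in X -> Ind_Iirr G i = Ind_Iirr G k -> ('chi_k \in 'chi_i ^: G)%CF.
  by move=> Xk eq_ik; apply: cfclass_Ind_irr; rewrite ?irrX' // -!IndE // eq_ik.
apply: (@leq_trans #|[set Ind_Iirr G i]|); last by rewrite cards1.
apply: subset_leq_card; apply/subsetP=> _ /imsetP[m Xm ->]; rewrite inE.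
rewrite -(inj_eq irr_inj) !IndE // eq_sym; apply/eqP; apply: cfclass_Ind => //.
apply: (three_conjugate_extensions (j := j) (l := l) nsHM nsMG
  (pgroup_nil pG) pr_MH _ inv_theta); rewrite ?iMH ?conjX //;
  by apply/eqP; rewrite -extX.
Qed.
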